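(* Let $\mathbb{K}$ be an algebraically closed field, let $A$ be a $\mathbb{K}$-algebra which is a domain, let $\alpha$ be a $\mathbb{K}$-automorphism of $A$, let $u\in Z(A)$ and let $R=R(A,\alpha,u-\alpha(u),1)$ be the corresponding conformal ambiskew polynomial ring, with Casimir element $z=xy-u$. Suppose that $A[y^{\pm 1};\alpha]$ is simple and that $Z(A[y^{\pm 1};\alpha])=\mathbb{K}$. Let $\lambda\in\mathbb{K}$. The ideal $(z-\lambda)R$ is maximal if and only if $(u+\lambda)A+\alpha^m(u+\lambda)A=A$ for all $m\geq 1$.
   Context: Rings are associative with $1$; $Z(\cdot)$ denotes the centre. For a $\mathbb{K}$-algebra $A$, a $\mathbb{K}$-automorphism $\alpha$ of $A$ and a central element $v\in A$, the ambiskew polynomial algebra $R(A,\alpha,v,1)$ is the iterated skew polynomial ring $A[y;\alpha][x;\beta,\delta]$, where $\beta=\alpha^{-1}$ on $A$, $\beta(y)=y$, and $\delta$ is the $\beta$-derivation of $A[y;\alpha]$ with $\delta(A)=0$ and $\delta(y)=v$. Thus $ya=\alpha(a)y$ and $xa=\alpha^{-1}(a)x$ for all $a\in A$, and $xy=yx+v$. When $v=u-\alpha(u)$ with $u$ central in $A$, the ring is called conformal and the Casimir element $z=xy-u$ is central in $R$. The ring $A[y^{\pm 1};\alpha]$ is the skew Laurent polynomial ring with $ya=\alpha(a)y$. *)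

(* Defs.v *)
From HB Require Import structures.
From mathcomp Require Import all_boot all_order all_algebra finmap.
From mathcomp Require Import monalg.

Set Implicit Arguments.
Unset Strict Implicit.
Unset Printing Implicit Defensive.

Import GRing.Theory.
Local Open Scope ring_scope.

Section NoncommutativeRings.
Variable R : nzRingType.
Implicit Types (a b r x y : R) (I J : R -> Prop).

(* No commutativity is assumed; 1 != 0 is part of [nzRingType]. *)
Definition is_domain := forall a b, a * b = 0 -> a = 0 \/ b = 0.

Definition central a := forall b, a * b = b * a.

Definition is_ideal I :=
  [/\ I 0, forall x y, I x -> I y -> I (x + y)
    & forall r x, I x -> I (r * x) /\ I (x * r)].

Definition maximal_ideal I :=
  [/\ is_ideal I, ~ I 1
    & forall J, is_ideal J -> (forall x, I x -> J x) ->
        (forall x, J x -> I x) \/ (forall x, J x)].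

(* Two-sided ideals only; a nzRingType is nonzero. *)
Definition simple_ring :=
  forall I, is_ideal I -> (forall x, I x -> x = 0) \/ (forall x, I x).

Definition right_principal a : R -> Prop := fun x => exists r, x = a * r.

Definition sum_is_whole I J := forall x, exists a b, [/\ I a, J b & x = a + b].

End NoncommutativeRings.

Arguments simple_ring R : clear implicits.
Arguments is_domain R : clear implicits.

Record skew_derivation (A : nzRingType) (s : A -> A) := SkewDerivation {
  skew_der :> {additive A -> A};
  skew_derM : forall a b, skew_der (a * b) = s a * skew_der b + skew_der a * b
}.

Section ZeroDerivation.
Variables (A : nzRingType) (s : A -> A).

Definition zero_fun (_ : A) : A := 0.
Lemma zero_fun_is_zmod_morphism : zmod_morphism zero_fun.
Proof. by move=> a b; rewrite /zero_fun subr0. Qed.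
HB.instance Definition _ :=
  GRing.isZmodMorphism.Build A A zero_fun zero_fun_is_zmod_morphism.

Lemma zero_funM a b : zero_fun (a * b) = s a * zero_fun b + zero_fun a * b.
Proof. by rewrite /zero_fun mulr0 mul0r addr0. Qed.

Definition zero_derivation := @SkewDerivation A s zero_fun zero_funM.
End ZeroDerivation.

(* The skew polynomial ring A[x; s, d]: the polynomial p stands for the sum of
   the p`_i x^i, coefficients on the left, and x a = s(a) x + d(a). *)
Record ore (A : nzRingType) (s : {rmorphism A -> A}) (d : skew_derivation s) :=
  Ore { ore_poly : {poly A} }.

Section Ore.
Variables (A : nzRingType) (s : {rmorphism A -> A}) (d : skew_derivation s).
Local Notation S := (ore d).
Implicit Types (p q r : {poly A}).

HB.instance Definition _ := [isNew for @ore_poly A s d].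
HB.instance Definition _ := [Choice of S by <:].

Lemma ore_poly_inj : injective (@ore_poly A s d). Proof. exact: val_inj. Qed.

Definition ore_zero : S := Ore d 0.
Definition ore_opp (f : S) : S := Ore d (- ore_poly f).
Definition ore_add (f g : S) : S := Ore d (ore_poly f + ore_poly g).

Fact ore_addA : associative ore_add.
Proof. by move=> f g h; apply: ore_poly_inj; rewrite /= addrA. Qed.
Fact ore_addC : commutative ore_add.
Proof. by move=> f g; apply: ore_poly_inj; rewrite /= addrC. Qed.
Fact ore_add0 : left_id ore_zero ore_add.
Proof. by move=> f; apply: ore_poly_inj; rewrite /= add0r. Qed.
Fact ore_addN : left_inverse ore_zero ore_opp ore_add.
Proof. by move=> f; apply: ore_poly_inj; rewrite /= addNr. Qed.

HB.instance Definition _ :=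
  GRing.isZmodule.Build S ore_addA ore_addC ore_add0 ore_addN.

(* Left multiplication by x: x (sum q_i x^i) = sum s(q_i) x^(i+1) + d(q_i) x^i *)
Definition ore_shift q : {poly A} := map_poly s q * 'X + map_poly d q.

Definition ore_mulp p q : {poly A} :=
  \sum_(i < size p) p`_i *: iter i ore_shift q.

Lemma coef_ore_shift q n :
  (ore_shift q)`_n = (if n == 0%N then 0 else s q`_n.-1) + d q`_n.
Proof. by rewrite coefD coefMX !coef_map_id0 ?raddf0. Qed.

Lemma ore_shiftD p q : ore_shift (p + q) = ore_shift p + ore_shift q.
Proof.
apply/polyP=> n; rewrite !(coefD, coef_ore_shift) !raddfD addrACA.
by case: (n == 0%N); rewrite ?addr0.
Qed.

Lemma ore_shift0 : ore_shift 0 = 0.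
Proof. by apply: (addrI (ore_shift 0)); rewrite -ore_shiftD !addr0. Qed.

Lemma ore_shiftZ a q : ore_shift (a *: q) = s a *: ore_shift q + d a *: q.
Proof.
apply/polyP=> n; rewrite !(coefD, coef_ore_shift, coefZ) skew_derM rmorphM.
by rewrite mulrDr !addrA; congr (_ + _ + _); case: (n == 0%N); rewrite ?mulr0.
Qed.

Lemma iter_ore_shiftD n p q :
  iter n ore_shift (p + q) = iter n ore_shift p + iter n ore_shift q.
Proof. by elim: n => //= n ->; rewrite ore_shiftD. Qed.

Lemma iter_ore_shift0 n : iter n ore_shift 0 = 0.
Proof. by elim: n => //= n ->; rewrite ore_shift0. Qed.

Lemma ore_mulpEw n p q : (size p <= n)%N ->
  ore_mulp p q = \sum_(i < n) p`_i *: iter i ore_shift q.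
Proof.
move=> le_pn; rewrite /ore_mulp.
rewrite (big_ord_widen _ (fun i => p`_i *: iter i ore_shift q) le_pn) big_mkcond.
by apply: eq_bigr => i _; case: ltnP => // /(nth_default _) ->; rewrite scale0r.
Qed.

Lemma ore_mulpDl p1 p2 q : ore_mulp (p1 + p2) q = ore_mulp p1 q + ore_mulp p2 q.
Proof.
set n := maxn (size p1) (size p2).
rewrite (@ore_mulpEw n _ _ (size_polyD _ _)).
rewrite (@ore_mulpEw n p1) ?leq_maxl // (@ore_mulpEw n p2) ?leq_maxr //.
by rewrite -big_split /=; apply: eq_bigr => i _; rewrite coefD scalerDl.
Qed.

Lemma ore_mulpDr p q1 q2 : ore_mulp p (q1 + q2) = ore_mulp p q1 + ore_mulp p q2.
Proof.
rewrite -big_split /=; apply: eq_bigr => i _.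
by rewrite iter_ore_shiftD scalerDr.
Qed.

Lemma ore_mul0p q : ore_mulp 0 q = 0.
Proof. by rewrite /ore_mulp size_poly0 big_ord0. Qed.

Lemma ore_mulp0 p : ore_mulp p 0 = 0.
Proof. by rewrite /ore_mulp big1 // => i _; rewrite iter_ore_shift0 scaler0. Qed.

Lemma ore_mulpZl a p q : ore_mulp (a *: p) q = a *: ore_mulp p q.
Proof.
rewrite (@ore_mulpEw (size p) _ _ (size_scale_leq _ _)) scaler_sumr.
by apply: eq_bigr => i _; rewrite coefZ scalerA.
Qed.

Lemma ore_mulCp a q : ore_mulp a%:P q = a *: q.
Proof.
by rewrite (@ore_mulpEw 1 _ _ (size_polyC_leq1 _)) big_ord1 coefC.
Qed.

Lemma ore_mulXp q : ore_mulp 'X q = ore_shift q.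
Proof.
by rewrite /ore_mulp size_polyX big_ord_recr big_ord1 /= !coefX scale0r scale1r add0r.
Qed.

Lemma ore_mulpMXl p q : ore_mulp (p * 'X) q = ore_mulp p (ore_shift q).
Proof.
rewrite (@ore_mulpEw (size p).+1); last first.
  by rewrite (leq_trans (size_polyMleq _ _)) // size_polyX addn2.
rewrite big_ord_recl coefMX /= scale0r add0r.
by apply: eq_bigr => i _; rewrite coefMX /= -iterSr.
Qed.

Lemma ore_mulp_shift p q : ore_mulp (ore_shift p) q = ore_shift (ore_mulp p q).
Proof.
elim/poly_ind: p q => [|p a IHp] q.
  by rewrite ore_shift0 ore_mul0p ore_shift0.
rewrite ore_shiftD ore_mulpDl (ore_mulpDl (p * 'X)) ore_shiftD; congr (_ + _).
  have -> : ore_shift (p * 'X) = ore_shift p * 'X.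
    apply/polyP=> -[|n]; rewrite !(coefMX, coef_ore_shift) /= ?raddf0 ?addr0 //.
    by case: n => [|n] /=; rewrite ?raddf0.
  by rewrite !ore_mulpMXl IHp.
have -> : ore_shift a%:P = s a *: 'X + (d a)%:P.
  apply/polyP=> -[|n]; rewrite !(coefD, coefZ, coefX, coefC, coef_ore_shift) /=.
    by rewrite mulr0.
  by rewrite raddf0; case: n => [|n] /=; rewrite ?rmorph0 ?mulr0 ?mulr1.
by rewrite ore_mulpDl ore_mulpZl ore_mulXp !ore_mulCp ore_shiftZ.
Qed.

Lemma ore_mulpA p q r : ore_mulp p (ore_mulp q r) = ore_mulp (ore_mulp p q) r.
Proof.
elim/poly_ind: p q => [|p a IHp] q; first by rewrite !ore_mul0p.
by rewrite !ore_mulpDl !ore_mulpMXl -ore_mulp_shift IHp !ore_mulCp ore_mulpZl.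
Qed.

Lemma ore_shiftXn n : ore_shift 'X^n = 'X^(n.+1).
Proof.
apply/polyP=> k; rewrite coef_ore_shift !coefXn.
have d1 : d 1 = 0.
  by apply: (addrI (d 1)); rewrite addr0 -[in RHS](mulr1 1) skew_derM rmorph1 mul1r mulr1.
have -> : d (k == n)%:R = 0 by case: (k == n); rewrite ?d1 ?raddf0.
by case: k => [|k] /=; rewrite ?addr0 // rmorph_nat.
Qed.

Lemma ore_mulp1 p : ore_mulp p 1%:P = p.
Proof.
rewrite /ore_mulp -[RHS]coefK poly_def; apply: eq_bigr => i _.
by congr (_ *: _); elim: (i : nat) => //= n ->; apply: ore_shiftXn.
Qed.

Definition ore_one : S := Ore d 1.
Definition ore_mul (f g : S) : S := Ore d (ore_mulp (ore_poly f) (ore_poly g)).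

Fact ore_mulA : associative ore_mul.
Proof. by move=> f g h; apply: ore_poly_inj; rewrite /= ore_mulpA. Qed.
Fact ore_mul1 : left_id ore_one ore_mul.
Proof. by move=> f; apply: ore_poly_inj; rewrite /= ore_mulCp scale1r. Qed.
Fact ore_mulr1 : right_id ore_one ore_mul.
Proof. by move=> f; apply: ore_poly_inj; rewrite /= ore_mulp1. Qed.
Fact ore_mulDl : left_distributive ore_mul +%R.
Proof. by move=> f g h; apply: ore_poly_inj; rewrite /= ore_mulpDl. Qed.
Fact ore_mulDr : right_distributive ore_mul +%R.
Proof. by move=> f g h; apply: ore_poly_inj; rewrite /= ore_mulpDr. Qed.
Fact ore_one_neq0 : ore_one != 0.
Proof.
by apply/eqP => /(congr1 (@ore_poly A s d)) /eqP; rewrite /= oner_eq0.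
Qed.

HB.instance Definition _ := GRing.Zmodule_isNzRing.Build S
  ore_mulA ore_mul1 ore_mulr1 ore_mulDl ore_mulDr ore_one_neq0.

Definition oreC (a : A) : S := Ore d a%:P.
Definition oreX : S := Ore d 'X.

Lemma oreC_is_zmod_morphism : zmod_morphism oreC.
Proof. by move=> a b; apply: ore_poly_inj; rewrite /= polyCB. Qed.
HB.instance Definition _ :=
  GRing.isZmodMorphism.Build A S oreC oreC_is_zmod_morphism.

Lemma oreC_is_monoid_morphism : monoid_morphism oreC.
Proof.
split=> [|a b]; apply: ore_poly_inj => //=.
by rewrite ore_mulCp polyCM mul_polyC.
Qed.
HB.instance Definition _ :=
  GRing.isMonoidMorphism.Build A S oreC oreC_is_monoid_morphism.

Lemma oreXC a : oreX * oreC a = oreC (s a) * oreX + oreC (d a).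
Proof.
apply: ore_poly_inj => /=; rewrite ore_mulXp ore_mulCp.
apply/polyP=> -[|n]; rewrite !(coefD, coefZ, coefX, coefC, coef_ore_shift) /=.
  by rewrite mulr0.
by rewrite raddf0; case: n => [|n] /=; rewrite ?rmorph0 ?mulr0 ?mulr1.
Qed.

Lemma ore_polyE (f : S) :
  f = \sum_(i < size (ore_poly f)) oreC (ore_poly f)`_i * oreX ^+ i.
Proof.
have opX n : ore_poly (oreX ^+ n) = 'X^n.
  by elim: n => // n IHn; rewrite exprS /= IHn ore_mulXp ore_shiftXn.
apply: ore_poly_inj; have op0 : ore_poly (0 : S) = 0 by [].
have opD : {morph @ore_poly A s d : g h / g + h} by [].
rewrite (big_morph _ opD op0) -[LHS]coefK poly_def; apply: eq_bigr => i _.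
by rewrite /= opX ore_mulCp.
Qed.

End Ore.

Arguments oreC {A s} d a.
Arguments oreX {A s} d.

Section RingAutomorphism.
Variable A : nzRingType.

Record ring_aut := RingAut {
  aut :> {rmorphism A -> A};
  aut_inv : A -> A;
  autK : cancel aut aut_inv;
  autVK : cancel aut_inv aut
}.

Variable alpha : ring_aut.

Lemma aut_inj : injective alpha. Proof. exact: can_inj (autK alpha). Qed.

Lemma aut_inv_is_zmod_morphism : zmod_morphism (aut_inv alpha).
Proof. by move=> a b; apply: aut_inj; rewrite raddfB /= !autVK. Qed.
HB.instance Definition _ :=
  GRing.isZmodMorphism.Build A A (aut_inv alpha) aut_inv_is_zmod_morphism.

Lemma aut_inv_is_monoid_morphism : monoid_morphism (aut_inv alpha).
Proof.
split=> [|a b]; apply: aut_inj; first by rewrite autVK rmorph1.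
by rewrite rmorphM /= !autVK.
Qed.
HB.instance Definition _ :=
  GRing.isMonoidMorphism.Build A A (aut_inv alpha) aut_inv_is_monoid_morphism.

Lemma central_aut a : central a -> central (alpha a).
Proof. by move=> aC b; rewrite -[b](autVK alpha) -!rmorphM aC. Qed.

Lemma central_sub_aut a : central a -> central (a - alpha a).
Proof. by move=> aC b; rewrite mulrBl mulrBr aC central_aut. Qed.

(* A[y; alpha] *)
Definition skew_poly := ore (zero_derivation alpha).
HB.instance Definition _ := GRing.NzRing.on skew_poly.

End RingAutomorphism.

Section Ambiskew.
Variables (A : nzRingType) (alpha : ring_aut A).
Variables (v : A) (vC : central v).
Local Notation alphaV := (aut_inv alpha).
Local Notation Ay := (skew_poly alpha).
Local Notation shift := (ore_shift (zero_derivation alpha)).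
Implicit Types (p q : {poly A}) (f g : Ay).

(* beta (sum a_i y^i) = sum alpha^-1(a_i) y^i *)
Definition amb_beta f : Ay := Ore _ (map_poly alphaV (ore_poly f)).

Lemma coef_shift q n : (shift q)`_n = if n == 0%N then 0 else alpha q`_n.-1.
Proof. by rewrite coef_ore_shift /= /zero_fun addr0. Qed.

Lemma ore_mulp_twist (T : {poly A} -> {poly A}) p q :
    {morph T : p q / p + q} -> (forall a q, T (a *: q) = alphaV a *: T q) ->
    (forall q, T (shift q) = shift (T q)) ->
  T (ore_mulp (zero_derivation alpha) p q)
    = ore_mulp (zero_derivation alpha) (map_poly alphaV p) (T q).
Proof.
move=> TD TZ Tsh.
have T0 : T 0 = 0 by move: (TZ 0 0); rewrite scale0r [alphaV 0]raddf0 scale0r.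
rewrite {1}/ore_mulp (big_morph _ TD T0).
rewrite (@ore_mulpEw _ _ _ (size p) (map_poly alphaV p)) ?size_poly //.
apply: eq_bigr => i _; rewrite TZ coef_map; congr (_ *: _).
by elim: (i : nat) => //= n <-.
Qed.

Lemma amb_beta_is_zmod_morphism : zmod_morphism amb_beta.
Proof. by move=> f g; apply: ore_poly_inj; rewrite /= rmorphB. Qed.
HB.instance Definition _ :=
  GRing.isZmodMorphism.Build Ay Ay amb_beta amb_beta_is_zmod_morphism.

Lemma amb_beta_is_monoid_morphism : monoid_morphism amb_beta.
Proof.
split=> [|f g]; apply: ore_poly_inj; rewrite /= ?rmorph1 //.
apply: (@ore_mulp_twist (map_poly alphaV)).
- exact: rmorphD.
- by move=> a q; rewrite map_polyZ.
- move=> q; apply/polyP=> n; rewrite !(coef_shift, coef_map) /=.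
  by case: (n == 0%N); rewrite ?raddf0 // autK autVK.
Qed.
HB.instance Definition _ :=
  GRing.isMonoidMorphism.Build Ay Ay amb_beta amb_beta_is_monoid_morphism.

(* As v is central and beta(y) = y, delta(y^n) = sum_(j < n) y^j v y^(n-1-j)
   = (sum_(j < n) alpha^j(v)) y^(n-1); delta is determined by this and by
   delta(a f) = alpha^-1(a) delta(f) for a in A. *)
Definition amb_trace n : A := \sum_(j < n) iter j alpha v.

Definition amb_deltap p : {poly A} :=
  \poly_(i < (size p).-1) (alphaV p`_i.+1 * amb_trace i.+1).

Definition amb_delta f : Ay := Ore _ (amb_deltap (ore_poly f)).

Lemma amb_traceS n : amb_trace n.+1 = v + alpha (amb_trace n).
Proof. by rewrite /amb_trace big_ord_recl raddf_sum. Qed.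

Lemma coef_amb_deltap p n :
  (amb_deltap p)`_n = alphaV p`_n.+1 * amb_trace n.+1.
Proof.
rewrite coef_poly; case: ltnP => // le_pn.
by rewrite nth_default ?raddf0 ?mul0r // (leq_trans (leqSpred _)) // ltnS.
Qed.

Lemma amb_deltapB : zmod_morphism amb_deltap.
Proof.
by move=> p q; apply/polyP=> n; rewrite coefB !coef_amb_deltap coefB raddfB mulrBl.
Qed.

Lemma amb_deltapD : {morph amb_deltap : p q / p + q}.
Proof.
by move=> p q; apply/polyP=> n; rewrite coefD !coef_amb_deltap coefD raddfD mulrDl.
Qed.

Lemma amb_deltap0 : amb_deltap 0 = 0.
Proof. by move: (amb_deltapB 0 0); rewrite !subrr. Qed.

Lemma amb_deltapZ a q : amb_deltap (a *: q) = alphaV a *: amb_deltap q.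
Proof.
by apply/polyP=> n; rewrite coefZ !coef_amb_deltap coefZ rmorphM mulrA.
Qed.

Lemma amb_deltap_shift q :
  amb_deltap (shift q) = shift (amb_deltap q) + v *: q.
Proof.
apply/polyP=> n; rewrite coefD coefZ coef_amb_deltap !coef_shift /= autK.
rewrite vC amb_traceS mulrDr addrC; congr (_ + _).
case: n => [|n] /=; first by rewrite /amb_trace big_ord0 raddf0 mulr0.
by rewrite coef_amb_deltap rmorphM autVK.
Qed.

Lemma amb_delta_is_zmod_morphism : zmod_morphism amb_delta.
Proof. by move=> f g; apply: ore_poly_inj; rewrite /= amb_deltapB. Qed.
HB.instance Definition _ :=
  GRing.isZmodMorphism.Build Ay Ay amb_delta amb_delta_is_zmod_morphism.

Lemma amb_deltaM f g :
  amb_delta (f * g) = amb_beta f * amb_delta g + amb_delta f * g.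
Proof.
apply: ore_poly_inj => /=; case: f g => p [q] /=.
elim/poly_ind: p q => [|p a IHp] q.
  by rewrite rmorph0 amb_deltap0 !ore_mul0p amb_deltap0 addr0.
have dMX : amb_deltap (p * 'X + a%:P) =
           ore_mulp (zero_derivation alpha) (amb_deltap p) 'X
           + ore_mulp (zero_derivation alpha) (map_poly alphaV p) v%:P.
  have /= := IHp 'X.
  have -> : amb_deltap 'X = v%:P.
    apply/polyP=> n; rewrite coef_amb_deltap coefX coefC eqSS.
    case: n => [|n] /=; last by rewrite raddf0 mul0r.
    by rewrite rmorph1 mul1r /amb_trace big_ord1.
  rewrite addrC => <-; rewrite amb_deltapD.
  have -> : amb_deltap a%:P = 0.
    by apply/polyP=> n; rewrite coef_amb_deltap coefC raddf0 mul0r coef0.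
  rewrite addr0; congr amb_deltap.
  have shX1 : 'X = shift 1%:P.
    by rewrite -ore_mulXp ore_mulp1.
  have -> // : ore_mulp (zero_derivation alpha) p 'X = p * 'X.
  by rewrite {1}shX1 -ore_mulpMXl ore_mulp1.
rewrite dMX (ore_mulpDl _ (p * 'X)) ore_mulpMXl amb_deltapD IHp amb_deltap_shift.
rewrite ore_mulCp amb_deltapZ ore_mulpDr.
have -> : map_poly alphaV (p * 'X + a%:P)
          = map_poly alphaV p * 'X + (alphaV a)%:P.
  by rewrite rmorphD rmorphM /= map_polyX map_polyC.
rewrite (ore_mulpDl _ (map_poly alphaV p * 'X)) ore_mulpMXl ore_mulCp.
rewrite (ore_mulpDl _ (ore_mulp _ _ 'X)) -!ore_mulpA ore_mulXp ore_mulCp.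
rewrite -!addrA; congr (_ + _); rewrite addrA addrC; congr (_ + _).
by rewrite addrC.
Qed.

Definition amb_derivation := @SkewDerivation Ay amb_beta amb_delta amb_deltaM.

(* R(A, alpha, v, 1) = A[y; alpha][x; beta, delta] *)
Definition ambiskew := ore amb_derivation.
HB.instance Definition _ := GRing.NzRing.on ambiskew.

Definition ambC (a : A) : ambiskew := oreC amb_derivation (oreC _ a).
Definition ambY : ambiskew := oreC amb_derivation (oreX _).
Definition ambX : ambiskew := oreX amb_derivation.

Lemma amb_deltaC a : amb_delta (oreC _ a) = 0.
Proof.
apply: ore_poly_inj; apply/polyP=> n.
by rewrite coef_amb_deltap coefC raddf0 mul0r coef0.
Qed.

Lemma amb_deltaY : amb_delta (oreX _) = oreC _ v.
Proof.
apply: ore_poly_inj; apply/polyP=> n.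
rewrite coef_amb_deltap coefX coefC eqSS.
case: n => [|n] /=; last by rewrite raddf0 mul0r.
by rewrite rmorph1 mul1r /amb_trace big_ord1.
Qed.

Lemma ambYC a : ambY * ambC a = ambC (alpha a) * ambY.
Proof. by rewrite -!rmorphM oreXC raddf0 addr0. Qed.

Lemma ambXE f : ambX * oreC amb_derivation f
  = oreC amb_derivation (amb_beta f) * ambX + oreC amb_derivation (amb_delta f).
Proof. exact: oreXC. Qed.

Lemma amb_betaC a : amb_beta (oreC _ a) = oreC _ (alphaV a).
Proof. by apply: ore_poly_inj; rewrite /= map_polyC. Qed.

Lemma amb_betaY : amb_beta (oreX _) = oreX _.
Proof. by apply: ore_poly_inj; rewrite /= map_polyX. Qed.

Lemma ambXC a : ambX * ambC a = ambC (alphaV a) * ambX.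
Proof.
by rewrite /ambC ambXE amb_betaC amb_deltaC (raddf0 (oreC amb_derivation)) addr0.
Qed.

Lemma ambXY : ambX * ambY = ambY * ambX + ambC v.
Proof. by rewrite /ambY ambXE amb_betaY amb_deltaY. Qed.

End Ambiskew.

Arguments ambC {A alpha v} vC a.
Arguments ambY {A} alpha {v} vC.
Arguments ambX {A} alpha {v} vC.

Section Conformal.
Variables (A : nzRingType) (alpha : ring_aut A).
Variables (u : A) (uC : central u).

Local Notation vC := (central_sub_aut alpha uC).

Definition conformal := ambiskew alpha vC.
HB.instance Definition _ := GRing.NzRing.on conformal.

Definition confC (a : A) : conformal := ambC vC a.
Definition casimir : conformal := ambX alpha vC * ambY alpha vC - confC u.
End Conformal.

(* A[y^{+-1}; alpha]: g stands for the sum of the g@_k y^k, k : int. *)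
Record skew_laurent (A : nzRingType) (alpha : ring_aut A) :=
  SkewLaurent { laurent_coefs : {malg A[int]} }.

Section SkewLaurent.
Variables (A : nzRingType) (alpha : ring_aut A).
Local Notation L := (skew_laurent alpha).
Implicit Types (g h : {malg A[int]}) (k l n : int) (a b : A).

HB.instance Definition _ := [isNew for @laurent_coefs A alpha].
HB.instance Definition _ := [Choice of L by <:].

Lemma laurent_coefs_inj : injective (@laurent_coefs A alpha).
Proof. exact: val_inj. Qed.

Definition laurent_zero : L := SkewLaurent alpha 0.
Definition laurent_opp (f : L) : L := SkewLaurent alpha (- laurent_coefs f).
Definition laurent_add (f g : L) : L :=
  SkewLaurent alpha (laurent_coefs f + laurent_coefs g).

Fact laurent_addA : associative laurent_add.
Proof. by move=> f g h; apply: laurent_coefs_inj; rewrite /= addrA. Qed.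
Fact laurent_addC : commutative laurent_add.
Proof. by move=> f g; apply: laurent_coefs_inj; rewrite /= addrC. Qed.
Fact laurent_add0 : left_id laurent_zero laurent_add.
Proof. by move=> f; apply: laurent_coefs_inj; rewrite /= add0r. Qed.
Fact laurent_addN : left_inverse laurent_zero laurent_opp laurent_add.
Proof. by move=> f; apply: laurent_coefs_inj; rewrite /= addNr. Qed.

HB.instance Definition _ :=
  GRing.isZmodule.Build L laurent_addA laurent_addC laurent_add0 laurent_addN.

(* alpha^k *)
Definition aut_exp k : A -> A :=
  match k with
  | Posz n => iter n alpha
  | Negz n => iter n.+1 (aut_inv alpha)
  end.

Lemma aut_exp_is_zmod_morphism k : zmod_morphism (aut_exp k).
Proof.
case: k => n a b; rewrite /aut_exp; first by elim: n => //= n ->; rewrite raddfB.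
by elim: n.+1 => //= m ->; rewrite raddfB.
Qed.
HB.instance Definition _ k :=
  GRing.isZmodMorphism.Build A A (aut_exp k) (aut_exp_is_zmod_morphism k).

Lemma aut_exp_is_monoid_morphism k : monoid_morphism (aut_exp k).
Proof.
case: k => n; split=> [|a b]; rewrite /aut_exp.
- by elim: n => //= n ->; rewrite rmorph1.
- by elim: n => //= n ->; rewrite rmorphM.
- by elim: n.+1 => //= m ->; rewrite rmorph1.
- by elim: n.+1 => //= m ->; rewrite rmorphM.
Qed.
HB.instance Definition _ k :=
  GRing.isMonoidMorphism.Build A A (aut_exp k) (aut_exp_is_monoid_morphism k).

Lemma aut_expS k a : aut_exp (k + 1) a = alpha (aut_exp k a).
Proof.
case: k => [n|[|n]]; [by rewrite -PoszD addn1 | by rewrite /= autVK |].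
have -> : Negz n.+1 + 1 = Negz n.
  by rewrite !NegzE (intS n.+1) opprD addrAC addNr add0r.
by rewrite /= autVK.
Qed.

Lemma aut_expB k a : aut_exp (k - 1) a = aut_inv alpha (aut_exp k a).
Proof. by rewrite -[k in RHS](subrK 1) aut_expS autK. Qed.

Lemma aut_expD k l a : aut_exp (k + l) a = aut_exp k (aut_exp l a).
Proof.
elim/int_rect: k => [|n IHn|n IHn]; first by rewrite add0r.
  by rewrite intS [1 + _]addrC addrAC !aut_expS -IHn.
by rewrite intS opprD [- 1 + _]addrC addrAC !aut_expB -IHn.
Qed.

Definition laurent_mulg g h : {malg A[int]} :=
  \sum_(k <- msupp g) \sum_(l <- msupp h)
     << g@_k * aut_exp k h@_l *g (k + l) >>.

(* Left multiplication by y^k. *)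
Definition laurent_shift k h : {malg A[int]} :=
  \sum_(l <- msupp h) << aut_exp k h@_l *g (k + l) >>.

Lemma coef_laurent_shift k h n :
  (laurent_shift k h)@_n = aut_exp k h@_(n - k).
Proof.
rewrite /laurent_shift raddf_sum /=.
under eq_bigr do rewrite mcoeffU.
have [hnk|hnk] := boolP (n - k \in msupp h); last first.
  rewrite mcoeff_outdom // raddf0 big1_seq // => l /andP[_ lh]; case: eqP => // nE.
  by case/negP: hnk; rewrite -nE addrC addKr.
rewrite (big_fsetD1 (n - k)) //= [k + _]addrC subrK eqxx mulr1n big1_seq ?addr0 //.
move=> l /andP[_]; rewrite !inE => /andP[ln _]; case: eqP => // nE.
by case/eqP: ln; rewrite -nE addrC addKr.
Qed.

Lemma laurent_mulgE g h :
  laurent_mulg g h = \sum_(k <- msupp g) g@_k *: laurent_shift k h.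
Proof.
apply: eq_bigr => k _; rewrite scaler_sumr; apply: eq_bigr => l _.
by apply/malgP=> n; rewrite mcoeffZ !mcoeffU mulrnAr.
Qed.

Lemma laurent_mulgEw (D : {fset int}) g h : (msupp g `<=` D)%fset ->
  laurent_mulg g h = \sum_(k <- D) g@_k *: laurent_shift k h.
Proof.
move=> gD; rewrite laurent_mulgE; apply/big_fset_incl => // k _ kg.
by rewrite mcoeff_outdom // scale0r.
Qed.

Lemma laurent_shiftD k g h :
  laurent_shift k (g + h) = laurent_shift k g + laurent_shift k h.
Proof. by apply/malgP=> n; rewrite mcoeffD !coef_laurent_shift mcoeffD raddfD. Qed.

Lemma laurent_shift0 k : laurent_shift k 0 = 0.
Proof. by apply/malgP=> n; rewrite coef_laurent_shift !mcoeff0 raddf0. Qed.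

Lemma laurent_shiftZ k a h :
  laurent_shift k (a *: h) = aut_exp k a *: laurent_shift k h.
Proof.
by apply/malgP=> n; rewrite mcoeffZ !coef_laurent_shift mcoeffZ rmorphM.
Qed.

Lemma laurent_shift_comp k l h :
  laurent_shift k (laurent_shift l h) = laurent_shift (k + l) h.
Proof.
apply/malgP=> n; rewrite !coef_laurent_shift aut_expD.
by rewrite opprD addrA.
Qed.

Lemma laurent_mulgDl g1 g2 h :
  laurent_mulg (g1 + g2) h = laurent_mulg g1 h + laurent_mulg g2 h.
Proof.
rewrite (laurent_mulgEw _ (msuppD_le g1 g2)).
rewrite (laurent_mulgEw _ (fsubsetUl (msupp g1) (msupp g2))).
rewrite (laurent_mulgEw _ (fsubsetUr (msupp g1) (msupp g2))).
by rewrite -big_split /=; apply: eq_bigr => k _; rewrite mcoeffD scalerDl.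
Qed.

Lemma laurent_mulgDr g h1 h2 :
  laurent_mulg g (h1 + h2) = laurent_mulg g h1 + laurent_mulg g h2.
Proof.
rewrite !laurent_mulgE -big_split /=.
by apply: eq_bigr => k _; rewrite laurent_shiftD scalerDr.
Qed.

Lemma laurent_mul0g h : laurent_mulg 0 h = 0.
Proof. by rewrite laurent_mulgE msupp0 big_nil. Qed.

Lemma laurent_mulUg a k h : laurent_mulg << a *g k >> h = a *: laurent_shift k h.
Proof. by rewrite (laurent_mulgEw _ msuppU_le) big_seq_fset1 mcoeffUU. Qed.

Lemma laurent_shiftU k l a :
  laurent_shift k << a *g l >> = << aut_exp k a *g (k + l) >>.
Proof.
apply/malgP=> n; rewrite coef_laurent_shift !mcoeffU raddfMn /=; congr (_ *+ _).
by rewrite eq_sym subr_eq addrC eq_sym.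
Qed.

Lemma laurent_mulg_sum (I : Type) (r : seq I) (F : I -> {malg A[int]}) h :
  laurent_mulg (\sum_(i <- r) F i) h = \sum_(i <- r) laurent_mulg (F i) h.
Proof.
apply: (big_morph (fun g => laurent_mulg g h)); last exact: laurent_mul0g.
by move=> g1 g2; apply: laurent_mulgDl.
Qed.

Lemma laurent_shift_sum (I : Type) (r : seq I) (F : I -> {malg A[int]}) k :
  laurent_shift k (\sum_(i <- r) F i) = \sum_(i <- r) laurent_shift k (F i).
Proof.
apply: (big_morph (laurent_shift k)); last exact: laurent_shift0.
by move=> g1 g2; apply: laurent_shiftD.
Qed.

Lemma laurent_mulgZl a g h : laurent_mulg (a *: g) h = a *: laurent_mulg g h.
Proof.
rewrite (laurent_mulgEw _ (msuppZ_le a g)) laurent_mulgE scaler_sumr.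
by apply: eq_bigr => k _; rewrite mcoeffZ scalerA.
Qed.

Lemma laurent_mulg_shift k g h :
  laurent_mulg (laurent_shift k g) h = laurent_shift k (laurent_mulg g h).
Proof.
rewrite [laurent_shift k g]/laurent_shift laurent_mulg_sum laurent_mulgE.
rewrite laurent_shift_sum; apply: eq_bigr => l _.
by rewrite laurent_mulUg laurent_shiftZ laurent_shift_comp.
Qed.

Lemma laurent_mulgA f g h :
  laurent_mulg f (laurent_mulg g h) = laurent_mulg (laurent_mulg f g) h.
Proof.
rewrite !(laurent_mulgE f) laurent_mulg_sum; apply: eq_bigr => k _.
by rewrite laurent_mulgZl laurent_mulg_shift.
Qed.

Lemma laurent_mul1g g : laurent_mulg << 1 *g 0 >> g = g.
Proof.
rewrite laurent_mulUg scale1r; apply/malgP=> n.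
by rewrite coef_laurent_shift subr0.
Qed.

Lemma laurent_mulg1 g : laurent_mulg g << 1 *g 0 >> = g.
Proof.
rewrite laurent_mulgE [RHS]monalgE; apply: eq_bigr => k _.
rewrite laurent_shiftU rmorph1 addr0; apply/malgP=> n.
by rewrite mcoeffZ !mcoeffU mulr_natr.
Qed.

Definition laurent_one : L := SkewLaurent alpha << 1 *g 0 >>.
Definition laurent_mul (f g : L) : L :=
  SkewLaurent alpha (laurent_mulg (laurent_coefs f) (laurent_coefs g)).

Fact laurent_mulA : associative laurent_mul.
Proof. by move=> f g h; apply: laurent_coefs_inj; rewrite /= laurent_mulgA. Qed.
Fact laurent_mul1 : left_id laurent_one laurent_mul.
Proof. by move=> f; apply: laurent_coefs_inj; rewrite /= laurent_mul1g. Qed.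
Fact laurent_mulr1 : right_id laurent_one laurent_mul.
Proof. by move=> f; apply: laurent_coefs_inj; rewrite /= laurent_mulg1. Qed.
Fact laurent_mulDl : left_distributive laurent_mul +%R.
Proof. by move=> f g h; apply: laurent_coefs_inj; rewrite /= laurent_mulgDl. Qed.
Fact laurent_mulDr : right_distributive laurent_mul +%R.
Proof. by move=> f g h; apply: laurent_coefs_inj; rewrite /= laurent_mulgDr. Qed.
Fact laurent_one_neq0 : laurent_one != 0.
Proof.
apply/eqP => /(congr1 (@laurent_coefs A alpha)) /= /(congr1 (mcoeff 0)) /eqP.
by rewrite mcoeffUU mcoeff0 oner_eq0.
Qed.

HB.instance Definition _ := GRing.Zmodule_isNzRing.Build L
  laurent_mulA laurent_mul1 laurent_mulr1 laurent_mulDl laurent_mulDr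
  laurent_one_neq0.

Definition laurentC a : L := SkewLaurent alpha << a *g 0 >>.
Definition laurentY k : L := SkewLaurent alpha << 1 *g k >>.

Lemma laurentYC a : laurentY 1 * laurentC a = laurentC (alpha a) * laurentY 1.
Proof.
apply: laurent_coefs_inj; rewrite /= !laurent_mulUg !laurent_shiftU scale1r.
rewrite rmorph1 addr0 add0r; apply/malgP=> n.
by rewrite mcoeffZ !mcoeffU mulr_natr.
Qed.

Lemma laurentYD k l : laurentY k * laurentY l = laurentY (k + l).
Proof.
apply: laurent_coefs_inj.
by rewrite /= laurent_mulUg laurent_shiftU scale1r rmorph1.
Qed.

End SkewLaurent.

(* Main.v *)
(* Put w = u + lambda. Sending x to w y^-1 defines a ring morphism phi from R to
   the skew Laurent ring, which kills z - lambda. Modulo z - lambda every element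
   is a sum of terms a y^i and a x^i, and phi is injective on those when w is a
   nonzero element of a domain; so the kernel of phi is then (z - lambda)R.

   If w and alpha^m(w) are comaximal for all m, an ideal J strictly larger than
   (z - lambda)R spans, after multiplication by powers of y, a nonzero ideal of the
   simple Laurent ring; hence J contains some y^n. As J then contains
   x y^n = w y^(n-1) and y^n x = alpha^n(w) y^(n-1) modulo z - lambda, it contains
   y^(n-1), and so on down to 1.

   Conversely, let B = wA + alpha^m(w)A. The elements r such that the constant term
   of phi(s r t) lies in B for all s, t form an ideal that contains z - lambda and
   y^m; maximality forces it to contain 1, so that 1 is in B. *)

Require Import Defs.
From mathcomp Require Import all_boot all_order all_algebra.
From HB Require Import structures.
From mathcomp Require Import finmap monalg.
From mathcomp Require Import zify.

Import Order.TTheory GRing.Theory Num.Theory.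
Local Open Scope ring_scope.

(** * Two-sided ideals and those generated by a central element *)

Section Ideals.
Context {R : nzRingType}.
Implicit Types (a x : R) (I : R -> Prop).

Lemma ideal_add {I} (idI : is_ideal I) x y : I x -> I y -> I (x + y).
Proof. by case: idI => _ + _; apply. Qed.

Lemma ideal_mull {I} (idI : is_ideal I) r x : I x -> I (r * x).
Proof. by case: idI => _ _ idM /(idM r)[]. Qed.

Lemma ideal_mulr {I} (idI : is_ideal I) r x : I x -> I (x * r).
Proof. by case: idI => _ _ idM /(idM r)[]. Qed.

Lemma ideal_sub {I} (idI : is_ideal I) x y : I x -> I y -> I (x - y).
Proof. by move=> Ix Iy; rewrite -mulN1r; exact: ideal_add (ideal_mull idI _ _ Iy). Qed.

Lemma ideal_big {I} (idI : is_ideal I) (T : Type) (r : seq T) (F : T -> R) :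
  (forall i, I (F i)) -> I (\sum_(i <- r) F i).
Proof.
move=> IF; elim/big_ind: _ => // [|x y]; first by case: idI.
exact: ideal_add.
Qed.

Lemma ideal_sum {I J : R -> Prop} : is_ideal I -> is_ideal J ->
  is_ideal (fun x => exists a b, [/\ I a, J b & x = a + b]).
Proof.
move=> idI idJ; have [[I0 _ _] [J0 _ _]] := (idI, idJ); split.
- by exists 0, 0; rewrite addr0.
- move=> _ _ [a [b [Ia Jb ->]]] [a' [b' [Ia' Jb' ->]]].
  by exists (a + a'), (b + b'); split; [exact: ideal_add.. | exact: addrACA].
- move=> r _ [a [b [Ia Jb ->]]]; split.
    exists (r * a), (r * b); split; [exact: ideal_mull.. | exact: mulrDr].
  exists (a * r), (b * r); split; [exact: ideal_mulr.. | exact: mulrDl].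
Qed.

(** Since [a] is central, s(ar) = a(sr), so the right ideal absorbs left multiplication too. *)
Lemma right_principal_central a : central a -> is_ideal (right_principal a).
Proof.
move=> aC; split=> [|x y [r ->] [s ->]|s x [r ->]].
- by exists 0; rewrite mulr0.
- by exists (r + s); rewrite mulrDr.
- by split; [exists (s * r); rewrite mulrA -aC mulrA | exists (r * s); rewrite mulrA].
Qed.

Lemma right_principal_sum_is_whole a b : (exists c d, 1 = a * c + b * d) ->
  sum_is_whole (right_principal a) (right_principal b).
Proof.
move=> [c [d cd]] x; exists (a * (c * x)), (b * (d * x)).
by split; [exists (c * x) | exists (d * x) | rewrite !mulrA -mulrDl -cd mul1r].
Qed.

End Ideals.

(** * Universal property of skew polynomial rings *)

Section OreExtension.
Context {A : nzRingType} {s : {rmorphism A -> A}} {d : skew_derivation s}.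

Lemma ore_ind (P : ore d -> Prop) :
    P 0 -> (forall a, P (oreC d a)) -> P (oreX d) ->
    (forall f g, P f -> P g -> P (f + g)) ->
    (forall f g, P f -> P g -> P (f * g)) ->
  forall f, P f.
Proof.
move=> P0 PC PX PD PM f; rewrite (ore_polyE f); elim/big_rec: _ => // i g _ Pg.
apply: (PD) => //; apply: (PM) => //; elim: (i : nat) => [|n IHn].
  by rewrite expr0 -(rmorph1 (oreC d)); apply: PC.
by rewrite exprS; apply: (PM).
Qed.

Context {B : nzRingType} {f : {rmorphism A -> B}} {X : B}.
Hypothesis XC : forall a, X * f a = f (s a) * X + f (d a).

(** The relation is an argument so that the morphism structures below can be attached to
    [ore_lift XC]. *)
Definition ore_lift of (forall a, X * f a = f (s a) * X + f (d a)) :=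
  fun g : ore d => (map_poly f (ore_poly g)).[X].
Local Notation lift := (ore_lift XC).

Lemma ore_liftE g :
  lift g = \sum_(i < size (ore_poly g)) f (ore_poly g)`_i * X ^+ i.
Proof.
rewrite /ore_lift (@horner_coef_wide _ (size (ore_poly g))) ?size_poly //.
by apply: eq_bigr => i _; rewrite coef_map.
Qed.

Lemma ore_lift_is_zmod_morphism : zmod_morphism lift.
Proof. by move=> g h; rewrite /ore_lift /= rmorphB hornerD hornerN. Qed.
HB.instance Definition _ :=
  GRing.isZmodMorphism.Build (ore d) B lift ore_lift_is_zmod_morphism.

(** As [ore_shift] is left multiplication by x, this is multiplicativity of the lift when the left
    factor is x; the relation [XC] enters here. *)
Lemma ore_lift_shift q :
  (map_poly f (ore_shift d q)).[X] = X * (map_poly f q).[X].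
Proof.
elim/poly_ind: q => [|q a IHq].
  by rewrite ore_shift0 rmorph0 horner0 mulr0.
have -> : ore_shift d (q * 'X + a%:P) = ore_shift d q * 'X + (s a *: 'X + (d a)%:P).
  apply/polyP=> -[|n];
    rewrite !(coefD, coefZ, coefX, coefC, coef_ore_shift, coefMX) /=.
    by rewrite add0r mulr0 !add0r.
  case: n => [|n] /=; rewrite !(addr0, add0r, mulr1, mulr0) //.
  by rewrite addrC.
move: (ore_shift d q) IHq => sq IHq.
rewrite !(rmorphD, rmorphM) /= map_polyX !map_polyC /= map_polyZ map_polyX.
by rewrite !(hornerD, hornerMX, hornerC, hornerZ, hornerX) IHq -XC mulrDr mulrA.
Qed.

Lemma ore_lift_is_monoid_morphism : monoid_morphism lift.
Proof.
split=> [|[p] [q]]; rewrite /ore_lift /=; first by rewrite rmorph1 hornerC.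
elim/poly_ind: p q => [|p a IHp] q.
  by rewrite ore_mul0p rmorph0 horner0 mul0r.
rewrite ore_mulpDl ore_mulpMXl ore_mulCp !rmorphD /= hornerD IHp ore_lift_shift.
rewrite rmorphM /= map_polyX map_polyC /= hornerD hornerMX hornerC.
by rewrite map_polyZ hornerZ mulrDl mulrA.
Qed.
HB.instance Definition _ :=
  GRing.isMonoidMorphism.Build (ore d) B lift ore_lift_is_monoid_morphism.

Lemma ore_liftC a : lift (oreC d a) = f a.
Proof. by rewrite /ore_lift /= map_polyC hornerC. Qed.

Lemma ore_liftX : lift (oreX d) = X.
Proof. by rewrite /ore_lift /= map_polyX hornerX. Qed.

End OreExtension.

(** * Coefficients and monomials of skew Laurent polynomials *)

Section Laurent.
Context {A : nzRingType} {alpha : ring_aut A}.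
Local Notation L := (skew_laurent alpha).
Implicit Types (f g : L) (k l n : int) (a b : A).

Definition lcoef f n : A := (laurent_coefs f)@_n.
Definition lmono a k : L := SkewLaurent alpha << a *g k >>.

Lemma lcoefP f g : (forall n, lcoef f n = lcoef g n) -> f = g.
Proof. by move=> fg; apply: laurent_coefs_inj; apply/malgP. Qed.

Lemma lcoefD f g n : lcoef (f + g) n = lcoef f n + lcoef g n.
Proof. exact: mcoeffD. Qed.

Lemma lcoef0 n : lcoef 0 n = 0.
Proof. exact: mcoeff0. Qed.

Lemma lcoef_sum (I : Type) (r : seq I) (F : I -> L) n :
  lcoef (\sum_(i <- r) F i) n = \sum_(i <- r) lcoef (F i) n.
Proof.
by apply: (big_morph (lcoef^~ n)) => [f g|]; rewrite ?lcoefD ?lcoef0.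
Qed.

Lemma lcoef_mono a k n : lcoef (lmono a k) n = a *+ (k == n).
Proof. exact: mcoeffU. Qed.

Lemma lcoefM f g n : lcoef (f * g) n =
  \sum_(k <- msupp (laurent_coefs f)) lcoef f k * aut_exp alpha k (lcoef g (n - k)).
Proof.
rewrite {1}/lcoef /= laurent_mulgE raddf_sum /=.
by apply: eq_bigr => k _; rewrite mcoeffZ coef_laurent_shift.
Qed.

Lemma lmonoE a k : lmono a k = laurentC alpha a * laurentY alpha k.
Proof.
apply: laurent_coefs_inj; rewrite /= laurent_mulUg; apply/malgP=> n.
by rewrite mcoeffZ coef_laurent_shift subr0 !mcoeffU /= mulr_natr.
Qed.

Lemma lcoef_monoM a k f n :
  lcoef (lmono a k * f) n = a * aut_exp alpha k (lcoef f (n - k)).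
Proof. by rewrite {1}/lcoef /= laurent_mulUg mcoeffZ coef_laurent_shift. Qed.

Lemma laurent_sum f :
  f = \sum_(k <- msupp (laurent_coefs f)) lmono (lcoef f k) k.
Proof.
apply: laurent_coefs_inj; rewrite [LHS]monalgE.
by rewrite (big_morph (@laurent_coefs A alpha) (id1 := 0) (op1 := +%R)).
Qed.

Lemma lmonoM a k b l :
  lmono a k * lmono b l = lmono (a * aut_exp alpha k b) (k + l).
Proof.
apply: lcoefP => n; rewrite lcoef_monoM !lcoef_mono raddfMn mulrnAr.
by rewrite [l == _]eq_sym subr_eq addrC eq_sym.
Qed.

Lemma laurentY_lmono l a k :
  laurentY alpha l * lmono a k = lmono (aut_exp alpha l a) (l + k).
Proof. by rewrite -[laurentY _ _]/(lmono _ _) lmonoM mul1r. Qed.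

Lemma lmono_laurentY a k l : lmono a k * laurentY alpha l = lmono a (k + l).
Proof. by rewrite -[laurentY _ _]/(lmono _ _) lmonoM rmorph1 mulr1. Qed.

Lemma laurentC_is_zmod_morphism : zmod_morphism (laurentC alpha).
Proof.
move=> a b; apply: lcoefP => n; rewrite lcoefD.
have -> : lcoef (- laurentC alpha b) n = - lcoef (laurentC alpha b) n by exact: mcoeffN.
by rewrite !lcoef_mono mulrnBl.
Qed.
HB.instance Definition _ :=
  GRing.isZmodMorphism.Build A L (laurentC alpha) laurentC_is_zmod_morphism.

Lemma laurentC_is_monoid_morphism : monoid_morphism (laurentC alpha).
Proof. by split=> // a b; rewrite -!/(lmono _ 0) lmonoM addr0. Qed.
HB.instance Definition _ :=
  GRing.isMonoidMorphism.Build A L (laurentC alpha) laurentC_is_monoid_morphism.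

(** The zero derivation is added to reach the shape that [ore_lift] asks for. *)
Lemma laurentY_skew a :
  laurentY alpha 1 * laurentC alpha a = laurentC alpha (alpha a) * laurentY alpha 1
    + laurentC alpha (zero_derivation alpha a).
Proof. by rewrite laurentYC raddf0 addr0. Qed.

Lemma laurentYX i : laurentY alpha 1 ^+ i = laurentY alpha i%:Z.
Proof. by elim: i => // i IHi; rewrite exprS IHi laurentYD. Qed.

Lemma aut_exp_central k a : central a -> central (aut_exp alpha k a).
Proof.
move=> aC b; rewrite -[b](_ : aut_exp alpha k (aut_exp alpha (- k) b) = b).
  by rewrite -!rmorphM aC.
by rewrite -aut_expD subrr.
Qed.

Definition skew_poly_laurent : skew_poly alpha -> L := ore_lift laurentY_skew.
HB.instance Definition _ := GRing.RMorphism.on skew_poly_laurent.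

Lemma lcoef_skew_poly (p : skew_poly alpha) n :
  lcoef (skew_poly_laurent p) n = if n is Posz i then (ore_poly p)`_i else 0.
Proof.
rewrite /skew_poly_laurent ore_liftE lcoef_sum.
under eq_bigr do rewrite laurentYX -lmonoE lcoef_mono.
case: n => [i|i]; last by rewrite big1.
have [ip|pi] := ltnP i (size (ore_poly p)).
  rewrite (bigD1 (Ordinal ip)) //= eqxx mulr1n big1 ?addr0 // => j ji.
  by case: eqP => // -[] /eqP; rewrite -val_eqE /= in ji *; rewrite (negPf ji).
rewrite nth_default // big1 // => j _.
by case: eqP => // -[ji]; move: (ltn_ord j); rewrite ji ltnNge pi.
Qed.

End Laurent.

HB.instance Definition _ {A : nzRingType} {alpha : ring_aut A} {v : A}
    (vC : central v) :=
  GRing.RMorphism.copy (@ambC A alpha v vC)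
    (oreC (amb_derivation alpha vC) \o oreC (zero_derivation alpha)).

(** * The morphism phi from R to the skew Laurent ring *)

Section Conformal.
Context {A : nzRingType} {alpha : ring_aut A} {u : A} (uC : central u).
(** [c] stands for the scalar lambda, of which centrality and invariance under [alpha] are
    retained. *)
Context {c : A} (cC : central c) (cfix : alpha c = c).
Local Notation L := (skew_laurent alpha).
Local Notation vC := (central_sub_aut alpha uC).
Local Notation R := (ambiskew alpha vC).
Local Notation w := (u + c).
Local Notation toL := (@skew_poly_laurent A alpha).
Local Notation polyR := (oreC (amb_derivation alpha vC)).
Local Notation X := (ambX alpha vC).
Local Notation Y := (ambY alpha vC).
Local Notation C := (ambC vC).

Lemma central_shift : central w.
Proof. by move=> b; rewrite mulrDl mulrDr uC cC. Qed.

Lemma central_iter_shift m : central (iter m alpha w).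
Proof. exact: (aut_exp_central (Posz m) w central_shift). Qed.

Lemma skew_poly_laurentC a : toL (oreC _ a) = laurentC alpha a.
Proof. exact: ore_liftC. Qed.

Lemma skew_poly_laurentX : toL (oreX _) = laurentY alpha 1.
Proof. exact: ore_liftX. Qed.

(** This is what allows x to be sent to w y^-1. The relation passes to products by the skew Leibniz
    rule, so it suffices to check it on A and on y. *)
Lemma laurent_ambiskew_relation f :
  lmono w (-1) * toL f
    = toL (amb_beta f) * lmono w (-1) + toL (amb_derivation alpha vC f).
Proof.
elim/(@ore_ind A alpha (zero_derivation alpha)): f => [|a||f g Pf Pg|f g Pf Pg].
- by rewrite !raddf0 mul0r mulr0 addr0.
- rewrite /= amb_betaC amb_deltaC raddf0 addr0 !skew_poly_laurentC.
  by rewrite -!/(lmono _ 0) !lmonoM /= central_shift addr0 add0r.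
- rewrite /= amb_betaY amb_deltaY skew_poly_laurentX skew_poly_laurentC.
  apply: lcoefP => n; rewrite lcoefD -!/(lmono _ _) !lmonoM !lcoef_mono.
  rewrite addNr subrr rmorph1 mulr1 mul1r -mulrnDl; congr (_ *+ _).
  (* On y the claim is w = alpha(w) + (u - alpha(u)), true because [alpha] fixes [c]. *)
  by rewrite /= rmorphD cfix [RHS]addrC addrA subrK.
- by rewrite !raddfD /= mulrDl mulrDr Pf Pg addrACA.
- rewrite !(rmorphM toL) mulrA Pf mulrDl -mulrA Pg mulrDr.
  by rewrite skew_derM raddfD /= !rmorphM /= !mulrA addrA.
Qed.

Definition conf_laurent : R -> L := ore_lift laurent_ambiskew_relation.
HB.instance Definition _ := GRing.RMorphism.on conf_laurent.
Local Notation phi := conf_laurent.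

Lemma conf_laurent_poly f : phi (polyR f) = toL f.
Proof. exact: ore_liftC. Qed.

Lemma conf_laurentC a : phi (C a) = laurentC alpha a.
Proof. by rewrite conf_laurent_poly skew_poly_laurentC. Qed.

Lemma conf_laurentY : phi Y = laurentY alpha 1.
Proof. by rewrite conf_laurent_poly skew_poly_laurentX. Qed.

Lemma conf_laurentYX n : phi (Y ^+ n) = laurentY alpha n%:Z.
Proof. by rewrite rmorphXn /= conf_laurentY laurentYX. Qed.

Lemma conf_laurentX : phi X = lmono w (-1).
Proof. exact: ore_liftX. Qed.

Lemma ambiskew_ind (P : R -> Prop) :
    P 0 -> (forall a, P (C a)) -> P X -> P Y ->
    (forall f g, P f -> P g -> P (f + g)) ->
    (forall f g, P f -> P g -> P (f * g)) ->
  forall f, P f.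
Proof.
move=> P0 PC PX PY PD PM; apply: ore_ind => // f.
elim/(@ore_ind A alpha (zero_derivation alpha)): f => [|a||f g Pf Pg|f g Pf Pg].
- by have -> : polyR 0 = 0 by exact: raddf0.
- exact: PC.
- exact: PY.
- by rewrite (rmorphD polyR); apply: PD.
- by rewrite (rmorphM polyR); apply: PM.
Qed.

(** * Centrality of the Casimir element *)

Local Notation z := (X * Y - C u).

Lemma casimir_YX : z = Y * X - C (alpha u).
Proof. by rewrite ambXY rmorphB /= -addrA addrAC subrr add0r. Qed.

(** It suffices to commute with the generators. For x and y, one side uses z = xy - u and the other
    z = yx - alpha(u). *)
Lemma casimir_central : central z.
Proof.
move=> f; elim/ambiskew_ind: f => [|a|||f g Pf Pg|f g Pf Pg].
- by rewrite mulr0 mul0r.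
- rewrite mulrBl mulrBr -mulrA ambYC mulrA ambXC autK -mulrA.
  by rewrite -!rmorphM uC.
- by rewrite {2}casimir_YX mulrBl mulrBr ambXC autK mulrA.
- by rewrite {1}casimir_YX mulrBl mulrBr ambYC mulrA.
- by rewrite [LHS]mulrDr [RHS]mulrDl Pf Pg.
- by rewrite mulrA Pf -mulrA Pg mulrA.
Qed.

Local Notation t := (z - C c).

Lemma central_casimir_sub : central t.
Proof.
have ac : aut_inv alpha c = c by rewrite -[c in LHS]cfix autK.
move=> f; rewrite mulrBl mulrBr casimir_central; congr (_ - _).
elim/ambiskew_ind: f => [|a|||f g Pf Pg|f g Pf Pg].
- by rewrite mulr0 mul0r.
- by rewrite -!rmorphM cC.
- by rewrite ambXC ac.
- by rewrite ambYC cfix.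
- by rewrite mulrDr mulrDl Pf Pg.
- by rewrite mulrA Pf -mulrA Pg mulrA.
Qed.

Lemma conf_laurent_casimir : phi t = 0.
Proof.
rewrite !rmorphB rmorphM /= conf_laurentX conf_laurentY !conf_laurentC.
rewrite -[laurentY _ _]/(lmono _ _) lmonoM rmorph1 mulr1 addNr.
by rewrite -[lmono _ _]/(laurentC alpha w) rmorphD /= addrAC addrK subrr.
Qed.

(* The powers x^n map to multiples of y^-n whose coefficient is the product of the
   alpha^j(u + c), -n < j <= 0; this divisibility survives sums and products. *)
Lemma lcoef_conf_laurent r n j : n < j -> j <= 0 ->
  right_principal (aut_exp alpha j w) (lcoef (phi r) n).
Proof.
have idw k : is_ideal (right_principal (aut_exp alpha k w)).
  by apply/right_principal_central/aut_exp_central/central_shift.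
have w0 k : right_principal (aut_exp alpha k w) 0 by case: (idw k).
elim/ambiskew_ind: r n j => [|a|||f g Pf Pg|f g Pf Pg] n j nj j0.
- by rewrite rmorph0 lcoef0.
- rewrite conf_laurentC lcoef_mono; case: eqP => // n0; lia.
- rewrite conf_laurentX lcoef_mono; case: eqP => // n1.
  have -> : j = 0 by lia.
  by exists 1; rewrite mulr1.
- rewrite conf_laurentY lcoef_mono; case: eqP => // n0; lia.
- rewrite (rmorphD phi) lcoefD.
  by apply: (ideal_add (idw j)); [exact: Pf | exact: Pg].
- rewrite (rmorphM phi) lcoefM; apply: (ideal_big (idw j)) => k.
  (* The k-th term is f_k alpha^k(g_(n-k)). If k < j, the first factor is divisible. Otherwise n - k
     < j - k <= 0, so alpha^(j-k)(w) divides g_(n-k), and alpha^k turns it into alpha^j(w). *)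
  have [kj|jk] := ltP k j; first exact/(ideal_mulr (idw j))/Pf.
  apply: (ideal_mull (idw j)); have [||b ->] := Pg (n - k) (j - k); [lia..|].
  by exists (aut_exp alpha k b); rewrite rmorphM /= -aut_expD addrC subrK.
Qed.

(** * From maximality to comaximality *)

Lemma comaximal_of_maximal m : maximal_ideal (right_principal t) -> (0 < m)%N ->
  sum_is_whole (right_principal w) (right_principal (iter m alpha w)).
Proof.
move=> [idt _ maxt] m0.
have idw : is_ideal (right_principal w).
  exact/right_principal_central/central_shift.
have idwm : is_ideal (right_principal (iter m alpha w)).
  exact/right_principal_central/central_iter_shift.
have idB := ideal_sum idw idwm; set B := fun x => _ in idB.
pose J (r : R) := forall s s', B (lcoef (phi (s * r * s')) 0).
have idJ : is_ideal J.
  split=> [s s'|r r' Jr Jr' s s'|r r' Jr'].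
  - by rewrite mulr0 mul0r rmorph0 lcoef0; case: idB.
  - by rewrite mulrDr mulrDl rmorphD lcoefD; apply: ideal_add.
  - by split=> s s'; [rewrite mulrA; apply: Jr' | rewrite -!mulrA mulrA; apply: Jr'].
have It r : right_principal t r -> J r.
  move=> [r' ->] s s'; rewrite !(rmorphM phi) /= conf_laurent_casimir.
  by rewrite mul0r mulr0 mul0r lcoef0; case: idB.
have JY : J (Y ^+ m).
  move=> s s'; rewrite -mulrA (rmorphM phi) lcoefM; apply: (ideal_big idB) => k.
  rewrite (rmorphM phi) /= conf_laurentYX -[laurentY _ _]/(lmono _ _) lcoef_monoM mul1r.
  (* Coefficients of phi(s) in negative degree are multiples of w, which settles k < 0. *)
  have [k0|k0] := ltP k 0.
    eexists; exists 0; split; last exact/esym/addr0.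
      exact: (ideal_mulr idw _ _ (lcoef_conf_laurent s k 0 k0 (lexx 0))).
    by case: idwm.
  exists 0; eexists; split; last exact/esym/add0r.
    by case: idw.
  apply: (ideal_mull idwm).
  (* For k >= 0 the other factor is alpha^(k+m) of the coefficient of phi(s') in degree -k-m. As m >
     0, that coefficient is a multiple of alpha^(-k)(w), hence its image is one of alpha^m(w). *)
  have [||b ->] := lcoef_conf_laurent s' (0 - k - m%:Z) (- k); [lia..|].
  exists (aut_exp alpha (k + m%:Z) b).
  by rewrite -aut_expD rmorphM /= -aut_expD addrAC subrr add0r.
case: (maxt J idJ It) => [JI|J1].
  (* [J] cannot lie inside the ideal of [t]: phi kills that ideal but not y^m. *)
  have [r Yr] := JI _ JY; move: (congr1 phi Yr).
  rewrite conf_laurentYX (rmorphM phi) /= conf_laurent_casimir mul0r.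
  move=> /(congr1 (lcoef^~ m%:Z)).
  by rewrite lcoef_mono eqxx lcoef0 => /eqP; rewrite oner_eq0.
have := J1 1 1 1; rewrite !mul1r rmorph1 lcoef_mono eqxx => -[_ [_ [[a ->] [b ->] ab]]].
by apply: right_principal_sum_is_whole; exists a, b.
Qed.

(** * Normal forms modulo z - lambda *)

Lemma subrDK (V : zmodType) (x a b : V) : x - a - b + (a + b) = x.
Proof. by rewrite -(addrA x) -opprD subrK. Qed.

Lemma casimir_sub_XY : X * Y = t + C w.
Proof. by rewrite [C w]rmorphD subrDK. Qed.

Lemma casimir_sub_YX : Y * X = t + C (alpha w).
Proof.
have -> : alpha w = alpha u + c by rewrite rmorphD cfix.
by rewrite casimir_YX (rmorphD C) subrDK.
Qed.

Definition normal_form (p : skew_poly alpha) (q : {poly A}) : R :=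
  polyR p + (map_poly (polyR \o oreC (zero_derivation alpha)) q).[X] * X.

Lemma normal_formD p1 q1 p2 q2 :
  normal_form (p1 + p2) (q1 + q2) = normal_form p1 q1 + normal_form p2 q2.
Proof.
by rewrite /normal_form raddfD rmorphD hornerD mulrDl addrACA.
Qed.

Lemma ambYXC n a : Y ^+ n * C a = C (iter n alpha a) * Y ^+ n.
Proof.
elim: n a => [|n IHn] a; first by rewrite !expr0 mul1r mulr1.
by rewrite exprSr -mulrA ambYC mulrA IHn -mulrA -iterSr.
Qed.

(** Modulo [I], an inner factor yx becomes alpha(w), lowering both exponents by one until one of
    them is 0. *)
Lemma monomial_normal_form {I : R -> Prop} (idI : is_ideal I) {s} (Is : I s)
    (YX : Y * X = s + C (alpha w)) a j i :
  exists p q, I (C a * Y ^+ j * X ^+ i - normal_form p q).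
Proof.
have I0 : I 0 by case: idI.
elim: j i a => [|j IHj] [|i] a.
- exists (oreC _ a), 0; rewrite /normal_form rmorph0 horner0 mul0r addr0.
  by rewrite !expr0 !mulr1 subrr.
- exists 0, (a *: 'X^i); rewrite /normal_form (raddf0 polyR) add0r map_polyZ hornerZ.
  by rewrite map_polyXn hornerXn expr0 mulr1 -mulrA -exprSr subrr.
- exists (oreC _ a * oreX _ ^+ j.+1), 0; rewrite /normal_form rmorph0 horner0 mul0r addr0.
  by rewrite rmorphM rmorphXn expr0 mulr1 subrr.
(* Moving alpha(w) to the left of y^j applies alpha^j to it. *)
have [p [q IH]] := IHj i (a * iter j alpha (alpha w)); exists p, q.
have -> : C a * Y ^+ j.+1 * X ^+ i.+1 = C a * Y ^+ j * (Y * X) * X ^+ i.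
  by rewrite exprSr exprS !mulrA.
rewrite YX mulrDr mulrDl -(mulrA (C a) _ (C _)) ambYXC (mulrA (C a)) -rmorphM -addrA.
exact/(ideal_add idI)/IH/(ideal_mulr idI)/(ideal_mull idI).
Qed.

Lemma normal_formP {I : R -> Prop} (idI : is_ideal I) {s} (Is : I s)
    (YX : Y * X = s + C (alpha w)) r :
  exists p q, I (r - normal_form p q).
Proof.
have sum_nf n (F : 'I_n -> R) :
    (forall i, exists p q, I (F i - normal_form p q)) ->
  exists p q, I (\sum_(i < n) F i - normal_form p q).
  move=> nfF; elim/big_rec: _ => [|i x _ [p [q xpq]]].
    exists 0, 0; rewrite /normal_form (raddf0 polyR) rmorph0 horner0 mul0r addr0 subrr.
    by case: idI.
  have [p' [q' Fpq]] := nfF i; exists (p' + p), (q' + q).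
  by rewrite normal_formD opprD addrACA; exact: (ideal_add idI _ _ Fpq xpq).
rewrite (ore_polyE r); apply: (sum_nf) => i; rewrite (ore_polyE (ore_poly r)`_i).
rewrite rmorph_sum mulr_suml; apply: (sum_nf) => j.
by rewrite rmorphM rmorphXn; exact: (monomial_normal_form idI Is YX).
Qed.

(** * The kernel of phi *)

Hypotheses (domA : is_domain A) (w0 : w != 0).

(** The coefficient b is the product of the alpha^(-j)(w) for 0 <= j < i, whose factors are nonzero
    elements of a domain. *)
Lemma lmono_exp_shift i : exists2 b, b != 0 & lmono w (-1) ^+ i = lmono b (- i%:Z) :> L.
Proof.
elim: i => [|i [b b0 IHi]]; first by exists 1; rewrite ?oner_neq0.
exists (b * aut_exp alpha (- i%:Z) w).
  apply/eqP => /domA[/eqP|/(congr1 (aut_exp alpha i%:Z))]; first by rewrite (negPf b0).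
  by rewrite -aut_expD subrr rmorph0; apply/eqP.
by rewrite exprSr IHi lmonoM; congr lmono; lia.
Qed.

(** Each q_i x^(i+1) lands in degree -(i+1) alone and [p] in degrees >= 0, so nothing mixes and
    every coefficient can be read off. *)
Lemma lcoef_normal_form p q n : lcoef (phi (normal_form p q)) n =
  match n with Posz i => (ore_poly p)`_i
             | Negz i => q`_i * lcoef ((lmono w (-1) : L) ^+ i.+1) n end.
Proof.
rewrite /normal_form rmorphD (rmorphM phi) /= conf_laurent_poly conf_laurentX.
rewrite -horner_map -map_poly_comp /= conf_laurentX lcoefD lcoef_skew_poly.
rewrite (@horner_coef_wide _ (size q)) ?size_poly // mulr_suml lcoef_sum.
under eq_bigr => k _.
  rewrite coef_map /= conf_laurentC -mulrA -exprSr.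
  have -> : lcoef (laurentC alpha q`_k * (lmono w (-1) : L) ^+ k.+1) n
    = q`_k * lcoef ((lmono w (-1) : L) ^+ k.+1) n.
    by rewrite -[laurentC _ _]/(lmono _ 0) lcoef_monoM subr0.
  over.
case: n => i.
  rewrite big1 ?addr0 // => k _; have [b _ ->] := lmono_exp_shift k.+1.
  by rewrite lcoef_mono; case: eqP => [|_]; [lia | rewrite mulr0].
rewrite add0r; have [iq|qi] := ltnP i (size q).
  rewrite (bigD1 (Ordinal iq)) //= big1 ?addr0 // => k ki.
  have [b _ ->] := lmono_exp_shift k.+1; rewrite lcoef_mono.
  by case: eqP => [e|_]; [case/eqP: ki; apply: val_inj => /=; lia | rewrite mulr0].
rewrite nth_default // mul0r big1 // => k _; have [b _ ->] := lmono_exp_shift k.+1.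
rewrite lcoef_mono; case: eqP => [e|_]; last by rewrite mulr0.
by have := ltn_ord k; lia.
Qed.

(** A normal form of [r] modulo [t] is also killed by phi; reading its coefficients, and cancelling
    the nonzero b in the domain, shows that it is 0. *)
Lemma conf_laurent_ker r : phi r = 0 -> right_principal t r.
Proof.
move=> r0; have idt := right_principal_central _ central_casimir_sub.
have It : right_principal t t by exists 1; rewrite mulr1.
have [p [q pq]] := normal_formP idt It casimir_sub_YX r.
have nf0 : phi (normal_form p q) = 0.
  case: pq => x /(congr1 phi); rewrite rmorphB (rmorphM phi) /= conf_laurent_casimir.
  by rewrite r0 mul0r sub0r => /eqP; rewrite oppr_eq0 => /eqP.
suff nf : normal_form p q = 0 by move: pq; rewrite nf (subr0 r).
have -> : p = 0.
  apply: ore_poly_inj; apply/polyP => i; rewrite coef0.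
  by have := lcoef_normal_form p q i; rewrite nf0 lcoef0.
have -> : q = 0.
  apply/polyP => i; rewrite coef0; have := lcoef_normal_form p q (Negz i).
  rewrite nf0 lcoef0; have [b b0 ->] := lmono_exp_shift i.+1.
  rewrite lcoef_mono NegzE eqxx => /esym/domA[//|/eqP].
  by rewrite (negPf b0).
by rewrite /normal_form (raddf0 polyR) rmorph0 horner0 mul0r addr0.
Qed.

(** * From comaximality to maximality *)

Let regroupl (S : nzRingType) (a b c' d f g : S) :
  a * b = c' * d -> a * (b * f) * g = c' * (d * f * g).
Proof. by rewrite !mulrA => ->. Qed.

Let regroupr (S : nzRingType) (a b c' d f g : S) :
  a * b = c' * d -> g * (f * a) * b = g * f * c' * d.
Proof. by rewrite -!mulrA => ->. Qed.

(** Powers of y clear denominators on either side. A factor a y^k is absorbed by adding d powers of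
    y with d + k >= 0: y can be moved past a at the cost of a power of alpha, and [J] absorbs the
    resulting element of R. *)
Lemma ideal_ambY_absorb (J : R -> Prop) : is_ideal J ->
  is_ideal (fun f : L => exists m n g,
    J g /\ laurentY alpha (Posz m) * f * laurentY alpha (Posz n) = phi g).
Proof.
move=> idJ; set J' := fun f : L => _.
have phiM b e : lmono b e%:Z = phi (C b * Y ^+ e).
  by rewrite (rmorphM phi) /= conf_laurentC conf_laurentYX lmonoE.
have phiMl b e g : phi (C b * Y ^+ e * g) = lmono b e%:Z * phi g.
  by rewrite (rmorphM phi) /= -phiM.
have phiMr b e g : phi (g * (C b * Y ^+ e)) = phi g * lmono b e%:Z.
  by rewrite (rmorphM phi) /= -phiM.
have pad f m n g i j : laurentY alpha (Posz m) * f * laurentY alpha (Posz n) = phi g ->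
    laurentY alpha (Posz (i + m)) * f * laurentY alpha (Posz (n + j))
      = phi (Y ^+ i * g * Y ^+ j).
  move=> fg; rewrite !(rmorphM phi) /= !conf_laurentYX -fg !PoszD.
  by rewrite -(laurentYD _ (Posz i)) -(laurentYD _ (Posz n)) !mulrA.
have lift (k : int) : exists d e : nat, d%:Z + k = e%:Z.
  by exists (absz k), (absz ((absz k)%:Z + k)); lia.
have J'0 : J' 0.
  by exists 0%N, 0%N, 0; rewrite mulr0 mul0r rmorph0; case: idJ.
have J'D f f' : J' f -> J' f' -> J' (f + f').
  move=> [m [n [g [Jg fg]]]] [m' [n' [g' [Jg' fg']]]].
  (* Both witnesses are padded to the common exponents m + m' and n + n'. *)
  exists (m' + m)%N, (n + n')%N, (Y ^+ m' * g * Y ^+ n' + Y ^+ m * g' * Y ^+ n).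
  split.
    apply: (ideal_add idJ); apply/(ideal_mulr idJ)/(ideal_mull idJ) => //.
  rewrite (rmorphD phi) [_ * (f + f')]mulrDr [LHS]mulrDl (pad _ _ _ _ _ _ fg).
  by rewrite addnC [(n + n')%N]addnC (pad _ _ _ _ _ _ fg').
have J'sum (r : L) (F : A -> int -> L) : (forall a k, J' (F a k)) ->
    J' (\sum_(k <- msupp (laurent_coefs r)) F (lcoef r k) k).
  by move=> J'F; apply: (big_ind J' J'0 J'D) => k _; exact: J'F.
split; [exact: J'0 | exact: J'D | move=> r f [m [n [g [Jg fg]]]]].
rewrite (laurent_sum r) mulr_suml mulr_sumr.
split.
  apply: (J'sum r (fun a k => lmono a k * f)) => a k.
  have [d [e dk]] := lift k.
  exists (d + m)%N, n, (C (aut_exp alpha (d + m)%N a) * Y ^+ e * g).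
  split; first exact: (ideal_mull idJ).
  have dm : (d + m)%N%:Z + k = e%:Z + m%:Z by lia.
  rewrite phiMl -fg; apply: regroupl.
  by rewrite laurentY_lmono dm lmono_laurentY.
apply: (J'sum r (fun a k => f * lmono a k)) => a k; have [d [e dk]] := lift k.
exists m, (n + d)%N, (g * (C (aut_exp alpha (- n%:Z) a) * Y ^+ e)).
split; first exact: (ideal_mulr idJ).
have dn : k + (n + d)%N%:Z = n%:Z + e%:Z by lia.
rewrite phiMr -fg; apply: regroupr.
by rewrite lmono_laurentY dn laurentY_lmono -aut_expD subrr.
Qed.

Lemma maximal_of_comaximal : simple_ring L ->
    (forall m, (0 < m)%N -> exists a b, 1 = w * a + iter m alpha w * b) ->
  maximal_ideal (right_principal t).
Proof.
move=> simpleL comax; have idt := right_principal_central _ central_casimir_sub.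
have phiI r : right_principal t r -> phi r = 0.
  by move=> [s ->]; rewrite (rmorphM phi) /= conf_laurent_casimir mul0r.
split=> // [|J idJ IJ].
  by move/phiI/eqP; rewrite rmorph1 oner_eq0.
(* [s] is [t] with its formula hidden: that formula contains [X * Y], which rewriting with [XY]
   would otherwise reach. *)
have [s [Js XY YX]] :
    exists s : R, [/\ J s, X * Y = s + C w & Y * X = s + C (alpha w)].
  exists t; split; [apply: IJ | exact: casimir_sub_XY | exact: casimir_sub_YX].
  by exists 1; rewrite mulr1.
have [J0|J1] := simpleL _ (ideal_ambY_absorb J idJ).
  (* Exponents m = n = 0 place phi(J) inside the zero ideal. *)
  left=> r Jr; apply/conf_laurent_ker/J0; exists 0%N, 0%N, r; split=> //.
  by rewrite mul1r mulr1.
right=> r; rewrite -[r]mulr1; apply: (ideal_mull idJ).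
(* Here 1 is in the Laurent ideal, so phi(g) = y^(m+n) for some [g] in [J]; the difference from
   [Y ^+ (m + n)] lies in the kernel, hence in [J]. *)
have [m [n [g [Jg]]]] := J1 1; rewrite mulr1 laurentYD -PoszD => Yg.
have : J (Y ^+ (m + n)).
  rewrite -[Y ^+ _](subrK g); apply: (ideal_add idJ) => //; apply/IJ/conf_laurent_ker.
  by rewrite (rmorphB phi) /= conf_laurentYX Yg subrr.
elim: (m + n)%N => [|k IHk] JY; first by rewrite expr0 in JY.
apply: IHk; have [a [b ab]] := comax k.+1 isT.
have JwY : J (C w * Y ^+ k).
  have -> : C w * Y ^+ k = X * Y ^+ k.+1 - s * Y ^+ k.
    by rewrite exprS mulrA XY mulrDl [s * _ + _]addrC addrK.
  by apply: (ideal_sub idJ); [exact: (ideal_mull idJ) | exact: (ideal_mulr idJ)].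
have JawY : J (C (iter k.+1 alpha w) * Y ^+ k).
  have -> : C (iter k.+1 alpha w) * Y ^+ k = Y ^+ k.+1 * X - Y ^+ k * s.
    by rewrite exprSr -mulrA YX mulrDr [_ * s + _]addrC addrK ambYXC -iterSr.
  by apply: (ideal_sub idJ); [exact: (ideal_mulr idJ) | exact: (ideal_mull idJ)].
have -> : Y ^+ k = C a * (C w * Y ^+ k) + C b * (C (iter k.+1 alpha w) * Y ^+ k).
  rewrite !mulrA -!rmorphM -mulrDl -rmorphD -central_shift -central_iter_shift -ab.
  by rewrite rmorph1 mul1r.
by apply: (ideal_add idJ); exact: (ideal_mull idJ).
Qed.
End Conformal.

Theorem corollary3p2 (K : closedFieldType) (A : algType K) (domA : is_domain A)
    (alpha : ring_aut A) (alphaZ : scalable alpha)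
    (u : A) (uC : central u)
    (simpleL : simple_ring (skew_laurent alpha))
    (centerL : forall f : skew_laurent alpha,
       central f <-> exists c : K, f = laurentC alpha c%:A)
    (lambda : K) :
  maximal_ideal (right_principal (casimir alpha uC - confC alpha uC lambda%:A)) <->
  (forall m : nat, (1 <= m)%N ->
     sum_is_whole (right_principal (u + lambda%:A))
                  (right_principal (iter m alpha (u + lambda%:A)))).
Proof.
have lC : central (lambda%:A : A) by move=> b; rewrite mulr_algl mulr_algr.
have lfix : alpha lambda%:A = lambda%:A by rewrite alphaZ rmorph1.
split=> [maxz m m0|comax]; first exact: (comaximal_of_maximal uC lC lfix m maxz m0).
have comax1 m : (0 < m)%N ->
    exists a b, 1 = (u + lambda%:A) * a + iter m alpha (u + lambda%:A) * b.
  by move=> /comax/(_ 1)[_ [_ [[a ->] [b ->] ab]]]; exists a, b.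
apply: (maximal_of_comaximal uC lC lfix domA _ simpleL comax1).
(* If w were 0, comaximality at m = 1 would give 1 = 0. *)
apply/eqP => w0; have [//|a [b]] := comax1 1%N.
by rewrite w0 /= rmorph0 !mul0r addr0 => /eqP; rewrite oner_eq0.
Qed.
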